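(* Let $X=(X_t)_{t\in\mathbb{R}_+}$ be an almost-continuous real valued process. If the support of $X_t$ is connected for every $t\in\mathbb{R}_+$ outside of a countable set, then $X$ is continuous.
   Context: A real valued process $X$ is \emph{almost-continuous} if it is cadlag, continuous in probability, and given any two independent cadlag processes $Y,Z$, each with the same distribution as $X$, and every $s<t\in\mathbb{R}_+$, the event $\{Y_s<Z_s,\ Y_t>Z_t\text{ and }Y_u\neq Z_u\text{ for every }u\in(s,t)\}$ has probability $0$ ($\sigma$-algebras being replaced by their universal completions where needed for measurability). The support of the real valued random variable $X_t$ is the smallest closed subset $C$ of $\mathbb{R}$ such that $\mathbb{P}(X_t\in C)=1$. A process is called continuous if, almost surely, its sample paths are continuous. *)

(* Defs.v *)
From mathcomp Require Import all_boot all_order all_algebra.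
From mathcomp Require Import all_classical all_reals all_analysis.
From mathcomp Require Import measurable_realfun.

Set Implicit Arguments.
Unset Strict Implicit.
Unset Printing Implicit Defensive.

Import Order.TTheory GRing.Theory Num.Theory.
Import numFieldNormedType.Exports.

Local Open Scope classical_set_scope.
Local Open Scope ring_scope.

(* Real valued processes indexed by R_+ are families R -> {RV P >-> R} of which
   only the members with index t >= 0 are ever considered. *)

Section paths.
Context {R : realType}.
Implicit Types x : R -> R.

Definition cadlag_path x : Prop :=
  (forall t : R, 0 <= t -> x s @[s --> t^'+] --> x t) /\
  (forall t : R, 0 < t -> cvg (x s @[s --> t^'-])).

Definition continuous_path x : Prop :=
  {within [set t : R | 0 <= t], continuous x}.

(* The product sigma-algebra: it only sees the restriction of a path to R_+. *)
Definition path_measurable : set (set (R -> R)) :=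
  <<s \bigcup_(t in [set t : R | 0 <= t])
        preimage_set_system setT (fun x : R -> R => x t) measurable >>.

End paths.

Section processes.
Context {R : realType} {d : measure_display} {T : measurableType d}.
Variable P : probability T R.
Implicit Types X Y Z : R -> {RV P >-> R}.

Definition sample_path X (w : T) : R -> R := fun t => X t w.

Definition cadlag X : Prop := forall w, cadlag_path (sample_path X w).

Definition continuous_process X : Prop :=
  {ae P, forall w, continuous_path (sample_path X w)}.

Definition continuous_in_probability X : Prop :=
  forall t e : R, 0 <= t -> 0 < e ->
    P [set w | e < `|X s w - X t w|]
      @[s --> within [set s : R | 0 <= s] (nbhs t)] --> 0%E.

Definition independent_processes Y Z : Prop :=
  forall A B, path_measurable A -> path_measurable B ->
    P (sample_path Y @^-1` A `&` sample_path Z @^-1` B) =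
    (P (sample_path Y @^-1` A) * P (sample_path Z @^-1` B))%E.

Definition crossing Y Z (s t : R) : set T :=
  [set w | [/\ Y s w < Z s w, Z t w < Y t w &
               forall u, s < u < t -> Y u w != Z u w]].

(* The support of a random variable; it is closed, and prob_rv_support below shows
   that it has probability 1, so that it is the smallest such set. *)
Definition rv_support (V : {RV P >-> R}) : set R :=
  \bigcap_(C in [set C | closed C /\ P (V @^-1` C) = 1%E]) C.

End processes.

Definition same_distribution {R : realType}
    {d : measure_display} {T : measurableType d} {P : probability T R}
    {d' : measure_display} {T' : measurableType d'} {P' : probability T' R}
    (X : R -> {RV P >-> R}) (Y : R -> {RV P' >-> R}) : Prop :=
  forall A, path_measurable A ->
    P (sample_path X @^-1` A) = P' (sample_path Y @^-1` A).

(* Y and Z may live on any probability space.  The crossing event belongs to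
   the universal completion of the sigma-algebra, hence to its P'-completion,
   where having probability 0 means being P'-negligible. *)
Definition almost_continuous {R : realType} {d : measure_display}
    {T : measurableType d} {P : probability T R}
    (X : R -> {RV P >-> R}) : Prop :=
  [/\ cadlag X,
      continuous_in_probability X &
      forall (d' : measure_display) (T' : measurableType d')
             (P' : probability T' R) (Y Z : R -> {RV P' >-> R}),
        cadlag Y -> cadlag Z ->
        same_distribution X Y -> same_distribution X Z ->
        independent_processes Y Z ->
        forall s t : R, 0 <= s -> s < t -> P'.-negligible (crossing Y Z s t)].

Section support_facts.
Context {R : realType} {d : measure_display} {T : measurableType d}.
Variables (P : probability T R) (V : {RV P >-> R}).

Lemma closed_rv_support : closed (rv_support V).
Proof. by apply: closed_bigI => C []. Qed.

Lemma prob_rv_support : P (V @^-1` rv_support V) = 1%E.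
Proof.
have mpre (A : set R) : measurable A -> measurable (V @^-1` A).
  by move=> mA; rewrite -[X in measurable X]setTI; exact: measurable_funPT.
have mS : measurable (V @^-1` rv_support V).
  by apply: mpre; apply: closed_measurable; exact: closed_rv_support.
suff N : P (~` (V @^-1` rv_support V)) = 0%E.
  by rewrite -[V @^-1` _]setCK probability_setC ?N ?sube0//; exact: measurableC.
pose F (n : nat) : set R :=
  if @unpickle (rat * rat)%type n is Some (q, r) then
    if `[< P (V @^-1` `]ratr q, ratr r[) = 0%E >] then `]ratr q, ratr r[%classic
    else set0
  else set0.
have NF n : P.-negligible (V @^-1` F n).
  rewrite /F; case: unpickle => [[q r]|]; last first.
    by rewrite preimage_set0; exact: negligible_set0.
  case: asboolP => [h|_]; last by rewrite preimage_set0; exact: negligible_set0.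
  by apply/negligibleP => //; exact: mpre.
apply: measure_negligible; first exact: measurableC.
apply: negligibleS (negligible_bigcup NF) => w /= /existsNP[C] /not_implyP[[cC PC]].
move=> nC.
have PnC : P (V @^-1` (~` C)) = 0%E.
  rewrite -preimage_setC probability_setC ?PC ?subee//.
  by apply: mpre; exact: closed_measurable.
have oC : open (~` C) by exact: closed_openC.
have [e /= e0 be] := (iffLR (nbhs_ballP (V w) (~` C))) (open_nbhs_nbhs (conj oC nC)).
have [q qI] := @rat_in_itvoo R (V w - e) (V w) ltac:(by rewrite ltrBlDr ltrDl).
have [r rI] := @rat_in_itvoo R (V w) (V w + e) ltac:(by rewrite ltrDl).
move: qI rI; rewrite !in_itv/= => /andP[q1 q2] /andP[r1 r2].
have Fqr : F (pickle (q, r)) = if `[< P (V @^-1` `]ratr q, ratr r[) = 0%E >]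
    then `]ratr q, ratr r[%classic else set0 by rewrite /F pickleK.
exists (pickle (q, r)); first exact: I.
rewrite /preimage /mkset {}Fqr.
case: asboolP => [_|]; first by rewrite /= in_itv/= q2 r1.
case; apply: (@subset_measure0 _ _ _ P _ (V @^-1` ~` C)).
- exact: mpre.
- by apply: mpre; exact: open_measurable.
- move=> v /=; rewrite in_itv/= => /andP[v1 v2]; apply: be => /=.
  rewrite /ball/= ltr_distlC; apply/andP; split.
    exact: lt_trans v1.
  exact: lt_trans v2 _.
- exact: PnC.
Qed.

End support_facts.

(* Main.v *)
From HB Require Import structures.
Require Import Defs.
From mathcomp Require Import all_boot all_order all_algebra.
From mathcomp Require Import all_classical all_reals all_analysis.
From mathcomp Require Import measurable_realfun.
From mathcomp Require Import lra.

Set Implicit Arguments.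
Unset Strict Implicit.

Import Order.TTheory GRing.Theory Num.Theory.
Import numFieldNormedType.Exports.

Local Open Scope classical_set_scope.
Local Open Scope ring_scope.

(** Suppose that the cadlag process X jumps with positive probability.  A jump
    crosses some rational gap ]a, b[, so for some rational s0 < t0 the event D,
    that X avoids ]a, b[ throughout [s0, t0] and starts and ends on opposite
    sides of it (say below, then above), has positive probability
    [discontinuity_leaps].  Consider phi(t) = P(D and X_t <= a), which falls
    from P(D) at s0 to 0 at t0, and is continuous because a change of side is
    a move of at least b - a, which is unlikely in a short time when X is
    continuous in probability.  So phi takes every value between 0 and P(D).
    Choose such a value outside the countable set of values that phi takes at
    rational times and at the exceptional times of the hypothesis, and a time t
    where phi takes it.  Two things follow [leaps_null].

    - X_t charges both ]-oo, a] and [b, +oo[, while t is not exceptional.  By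
      connectedness its support contains the gap, so X_t lies inside the gap
      with positive probability [connected_support_mass], and by right
      continuity X then stays there during some interval [t, q] with q rational
      [stays_mass].
    - phi(q) <> phi(t), so with positive probability X changes side over [t, q]
      without entering the gap.

    For two independent copies of X, with positive probability one leaps over
    the gap during [t, q] while the other remains inside it.  They have then
    exchanged their order without meeting, which almost-continuity forbids
    [leaps_over_null].  The copies are taken on the square of the probability
    space, where events that constrain one coordinate each are rectangles
    [crossing_rectangle_null]. *)

(** * Cadlag paths that stay in a set or leap over a gap *)

Section paths.
Context {R : realType}.
Implicit Types (A B C : set R) (x : R -> R) (a b s t u : R).

(** The times inside the interval are rational so that the event is measurable;
    [staysW] recovers all of them for closed C and cadlag paths.  The endpoints
    are listed because they may be irrational. *)
Definition stays C s t : set (R -> R) :=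
  [set x | [/\ C (x s), C (x t) &
     forall r : rat, s <= ratr r <= t -> C (x (ratr r))]].

(** For s < t and disjoint closed A and B, a cadlag path can only do this by
    a jump. *)
Definition leaps A B s t : set (R -> R) :=
  [set x | [/\ A (x s), B (x t) & stays (A `|` B) s t x]].

Lemma rat_between a b : a < b -> exists r : rat, a < ratr r < b.
Proof.
by move=> /rat_in_itvoo[r]; rewrite in_itv/= => ?; exists r.
Qed.

Lemma nbhs_right_ex x u (U : set R) : x s @[s --> u^'+] --> x u ->
  nbhs (x u) U -> exists2 e : R, 0 < e & forall s, u <= s < u + e -> U (x s).
Proof.
move=> xu Ux; have : \forall s \near u^'+, U (x s) := xu _ Ux.
rewrite near_withinE => /nbhs_ballP[e /= e0 be].
exists e => // s /andP[]; rewrite le_eqVlt => /predU1P[<- _|us sue].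
  exact: nbhs_singleton Ux.
apply: be => //=; rewrite /ball/= ltr_distlC; apply/andP; split; lra.
Qed.

(** Right continuity: a value outside the closed set C would persist until some
    later rational time. *)
Lemma staysW C s t x : cadlag_path x -> closed C -> 0 <= s ->
  stays C s t x -> forall u, s <= u <= t -> C (x u).
Proof.
move=> [xr _] cC s0 [_ Cxt Cxr] u /andP[su ut].
move: ut; rewrite le_eqVlt => /predU1P[->//|ut].
apply: contrapT => nC.
have [|e e0 xe] := @nbhs_right_ex x u (~` C) (xr _ (le_trans s0 su)).
  by apply: open_nbhs_nbhs; split => //; exact: closed_openC.
have [r /andP[ur]] : exists r : rat, u < ratr r < Order.min (u + e) t.
  by apply: rat_between; rewrite lt_min ltrDl e0.
rewrite lt_min => /andP[re rt].
apply: (xe (ratr r)); first by rewrite (ltW ur).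
by apply: Cxr; rewrite (ltW rt) (le_trans su (ltW ur)).
Qed.

Lemma stays_right C t0 t x : cadlag_path x -> 0 <= t -> t < t0 ->
  nbhs (x t) C -> exists2 q : rat, t < ratr q < t0 & stays C t (ratr q) x.
Proof.
move=> [xr _] t0' tt0 Cx.
have [e e0 xe] := nbhs_right_ex (xr _ t0') Cx.
have [q /andP[tq]] : exists r : rat, t < ratr r < Order.min (t + e) t0.
  by apply: rat_between; rewrite lt_min ltrDl e0.
rewrite lt_min => /andP[qe qt0]; exists q; first by rewrite tq.
split; [apply: xe|apply: xe|move=> r /andP[tr rq]; apply: xe]; lra.
Qed.

Lemma nbhs_lray (y a : R) : y < a -> nbhs y `]-oo, a]%classic.
Proof.
move=> ya; have : nbhs y `]-oo, a[%classic.
  by apply: open_nbhs_nbhs; split; [exact: lray_open|rewrite /= in_itv].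
by apply: filterS => z /=; rewrite !in_itv/= => /ltW.
Qed.

Lemma nbhs_rray (y b : R) : b < y -> nbhs y `[b, +oo[%classic.
Proof.
move=> yb; have : nbhs y `]b, +oo[%classic.
  by apply: open_nbhs_nbhs; split; [exact: rray_open|rewrite /= in_itv/= yb].
by apply: filterS => z /=; rewrite !in_itv/= !andbT => /ltW.
Qed.

(** At a discontinuity the left limit l and the value x u differ.  Rationals a, b
    strictly between them bound a gap that the path leaps over, upwards or
    downwards, on any rational interval around u that is short enough. *)
Lemma discontinuity_leaps x : cadlag_path x -> ~ continuous_path x ->
  exists a b s t : rat, [/\ ratr a < ratr b :> R, (0:R) <= ratr s,
    ratr s < ratr t :> R &
    (leaps `]-oo, ratr a] `[ratr b, +oo[ (ratr s) (ratr t) `|`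
     leaps `[ratr b, +oo[ `]-oo, ratr a] (ratr s) (ratr t)) x].
Proof.
move=> cx ncx; apply: contrapT => nl; apply: ncx.
have [xr xl] := cx.
apply/subspace_continuousP => u /= u0.
move: (u0); rewrite le_eqVlt => /predU1P[u0'|{}u0].
  subst u => U /(nbhs_right_ex (xr _ (lexx _)))[e e0 xe].
  suff : \forall s \near within [set t : R | 0 <= t] (nbhs (0 : R)), U (x s) by [].
  rewrite near_withinE; apply/nbhs_ballP; exists e => //= s.
  rewrite /ball/= ltr_distlC => /andP[? ?] /= ?; apply: xe; lra.
have xr' := xr _ (ltW u0).
have [l xl'] : exists l : R, x s @[s --> u^'-] --> l.
  by exists (lim (x s @[s --> u^'-])); exact: xl.
suff ll : l = x u.
  apply: cvg_within_filter; apply/left_right_continuousP; split => //.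
  by move: xl'; rewrite ll.
have leap_at_u (A B : set R) : nbhs l A -> nbhs (x u) B ->
    exists s t : rat, [/\ (0:R) <= ratr s, ratr s < ratr t :> R &
      leaps A B (ratr s) (ratr t) x].
  move=> Al; have : \forall s \near u^'-, A (x s) := xl' _ Al.
  rewrite near_withinE => /nbhs_ballP[e /= e0 xA].
  move=> /(nbhs_right_ex xr')[e' e'0 xB].
  have [s /andP[]] : exists r : rat, Order.max 0 (u - e) < ratr r < u.
    by apply: rat_between; rewrite gt_max u0 ltrBlDr ltrDl.
  rewrite gt_max => /andP[s0 es] su.
  have [t /andP[ut te']] : exists r : rat, u < ratr r < u + e'.
    by apply: rat_between; rewrite ltrDl.
  have {}xA v : ratr s <= v < u -> A (x v).
    move=> /andP[sv vu]; apply: xA => //; rewrite /ball/= ltr_distlC.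
    by apply/andP; split; lra.
  have {}xB v : u <= v <= ratr t -> B (x v).
    by move=> /andP[uv vt]; apply: xB; lra.
  have As : A (x (ratr s)) by apply: xA; rewrite lexx.
  have Bt : B (x (ratr t)) by apply: xB; rewrite lexx (ltW ut).
  exists s, t; split; [exact: ltW|exact: lt_trans ut|].
  split => //; split; [by left|by right|move=> r /andP[sr rt]].
  by have [ru|ur] := ltP (ratr r) u; [left; apply: xA|right; apply: xB];
    apply/andP.
apply/eqP; rewrite eq_le !leNgt; apply/andP; split; apply/negP => lu; apply: nl.
- have [a /andP[xa al]] := rat_between lu.
  have [b /andP[ab bl]] := rat_between al.
  have [s [t [s0 st H]]] := leap_at_u _ _ (nbhs_rray bl) (nbhs_lray xa).
  by exists a, b, s, t; split => //; right.
- have [a /andP[xa al]] := rat_between lu.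
  have [b /andP[ab bl]] := rat_between al.
  have [s [t [s0 st H]]] := leap_at_u _ _ (nbhs_lray xa) (nbhs_rray bl).
  by exists a, b, s, t; split => //; left.
Qed.

End paths.

(** * Null sets and countable sets *)

Section measure_complements.
Context {R : realType} {d : measure_display} {T : measurableType d}.

Lemma negligible_bigcup_countType (mu : {measure set T -> \bar R})
    (I : countType) (F : I -> set T) :
  (forall i, mu.-negligible (F i)) -> mu.-negligible (\bigcup_i F i).
Proof.
move=> F0; pose G n := if @unpickle I n is Some i then F i else set0.
have : mu.-negligible (\bigcup_n G n).
  apply: negligible_bigcup => n; rewrite /G; case: unpickle => [//|].
  exact: negligible_set0.
apply: negligibleS => w [i _ Fi]; exists (pickle i) => //.
by rewrite /G pickleK.
Qed.

Lemma le_measure_negligible (mu : {measure set T -> \bar R}) (A B N : set T) :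
  measurable A -> measurable B -> measurable N -> mu N = 0%E ->
  A `<=` B `|` N -> (mu A <= mu B)%E.
Proof.
move=> mA mB mN N0 AB; apply: (@le_trans _ _ (mu (B `|` N))).
  by apply: le_measure; rewrite ?inE//; exact: measurableU.
by rewrite -[leRHS]adde0 -N0; exact: measureU2.
Qed.

End measure_complements.

(** A countable set is Lebesgue-null, a nondegenerate interval is not. *)
Lemma countable_avoid {R : realType} (N : set R) a b : countable N -> a < b ->
  exists2 v, a < v < b & ~ N v.
Proof.
move=> cN ab; apply: contrapT => H.
have /(sub_countable)/(_ cN) : (`]a, b[%classic #<= N)%card.
  apply: subset_card_le => v; rewrite /= in_itv/= => vab.
  by apply: contrapT => nN; apply: H; exists v.
move/countable_lebesgue_measure0; rewrite lebesgue_measure_itv/= lte_fin ab.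
by move=> /eqP; rewrite -EFinD eqe subr_eq0 gt_eqF.
Qed.

(** * Events of a process *)

Section processes.
Context {R : realType} {d : measure_display} {T : measurableType d}.
Variable P : probability T R.
Implicit Types (X Y Z : R -> {RV P >-> R}) (A B C : set R).

Lemma measurable_rv_preimage (V : {RV P >-> R}) C :
  measurable C -> measurable (V @^-1` C).
Proof. exact: measurable_funPTI. Qed.

Lemma measurable_stays X C s t : measurable C ->
  measurable (sample_path X @^-1` stays C s t).
Proof.
move=> mC.
have -> : sample_path X @^-1` stays C s t =
    X s @^-1` C `&` X t @^-1` C `&`
    ~` (\bigcup_(r : rat) if s <= ratr r <= t then X (ratr r) @^-1` (~` C)
                          else set0).
  apply/seteqP; split => w /=.
    move=> [Cs Ct Cr]; split => // -[r _]; case: ifPn => //= sr; apply.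
    exact: Cr.
  move=> [[Cs Ct] Cr]; split => // r sr; apply: contrapT => nC.
  by apply: Cr; exists r => //; rewrite sr.
apply: measurableI; first by apply: measurableI; exact: measurable_rv_preimage.
apply: measurableC; apply: bigcupT_measurable_rat => r; case: ifPn => // _.
by apply: measurable_rv_preimage; exact: measurableC.
Qed.

Lemma measurable_leaps X A B s t : measurable A -> measurable B ->
  measurable (sample_path X @^-1` leaps A B s t).
Proof.
move=> mA mB.
have -> : sample_path X @^-1` leaps A B s t =
    X s @^-1` A `&` X t @^-1` B `&` sample_path X @^-1` stays (A `|` B) s t.
  by apply/seteqP; split => w /= [] // [].
apply: measurableI; last by apply: measurable_stays; exact: measurableU.
by apply: measurableI; exact: measurable_rv_preimage.
Qed.

Lemma measurable_sample_path X (A : set (R -> R)) :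
  path_measurable A -> measurable (sample_path X @^-1` A).
Proof.
move: A; apply: smallest_sub.
  have := @sigma_algebra_image _ _ setT (sample_path X) _
    (sigma_algebra_measurable T).
  by congr sigma_algebra; apply/seteqP; split => A /=;
    rewrite /image_set_system/= setTI.
move=> A [t _ [C mC <-]]; rewrite setTI.
exact: measurable_rv_preimage.
Qed.

(** * Two independent copies *)

Definition fst_rv (V : {RV P >-> R}) : T * T -> R := V \o fst.
Definition snd_rv (V : {RV P >-> R}) : T * T -> R := V \o snd.

Let measurable_fst_rv V : measurable_fun setT (fst_rv V).
Proof. by apply: measurableT_comp => //; exact: measurable_fst. Qed.

Let measurable_snd_rv V : measurable_fun setT (snd_rv V).
Proof. by apply: measurableT_comp => //; exact: measurable_snd. Qed.

HB.instance Definition _ V := isMeasurableFun.Build _ _ _ _ _ (measurable_fst_rv V).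
HB.instance Definition _ V := isMeasurableFun.Build _ _ _ _ _ (measurable_snd_rv V).

(** The two coordinate copies of X on T * T are independent and distributed as X,
    and a rectangle of probability P A * P B is contained in their crossing
    event. *)
Lemma crossing_rectangle_null X s t (A B : set T) :
  almost_continuous X -> 0 <= s -> s < t -> measurable A -> measurable B ->
  (forall w v, A w -> B v -> [/\ X s w < X s v, X t v < X t w &
     forall u, s < u < t -> X u w != X u v]) ->
  P A = 0%E \/ P B = 0%E.
Proof.
move=> [cX _ hX] s0 st mA mB AB.
pose Y t : {RV (P \x P)%E >-> R} := fst_rv (X t).
pose Z t : {RV (P \x P)%E >-> R} := snd_rv (X t).
have YE (C : set (R -> R)) :
    sample_path Y @^-1` C = (sample_path X @^-1` C) `*` setT.
  by apply/seteqP; split => -[w v] //= [].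
have ZE (C : set (R -> R)) :
    sample_path Z @^-1` C = setT `*` (sample_path X @^-1` C).
  by apply/seteqP; split => -[w v] //= [].
have PY (C : set (R -> R)) : path_measurable C ->
    (P \x P)%E (sample_path Y @^-1` C) = P (sample_path X @^-1` C).
  move=> mC; rewrite YE product_measure1E//; last exact: measurable_sample_path.
  by rewrite -[RHS]mule1 -(probability_setT P).
have PZ (C : set (R -> R)) : path_measurable C ->
    (P \x P)%E (sample_path Z @^-1` C) = P (sample_path X @^-1` C).
  move=> mC; rewrite ZE product_measure1E//; last exact: measurable_sample_path.
  by rewrite -[RHS]mul1e -(probability_setT P).
have indep : independent_processes Y Z.
  move=> C D mC mD; apply: etrans (esym (f_equal2 mule (PY C mC) (PZ D mD))).
  rewrite YE ZE -setXI setTI setIT.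
  by apply: product_measure1E; exact: measurable_sample_path.
have := hX _ _ _ Y Z (fun w => cX w.1) (fun w => cX w.2)
  (fun _ mC => esym (PY _ mC)) (fun _ mC => esym (PZ _ mC)) indep s t s0 st.
have AxB : A `*` B `<=` crossing Y Z s t by move=> [w v] [/= Aw Bv]; exact: AB.
move=> /(negligibleS AxB) /(measure_negligible (measurableX mA mB)).
move/(etrans (esym (product_measure1E P P mA mB)))/eqP.
by rewrite mule_eq0 => /orP[]/eqP; [left|right].
Qed.

(** A copy that remains in [a', b'] while another one leaps over [a, b] is
    overtaken without being met.  An upward leap is used as the first copy and
    a downward leap as the second, so that the crossing has the same direction
    in both cases. *)
Lemma leaps_over_null X s t a a' b' b :
  almost_continuous X -> 0 <= s -> s < t -> a < a' -> b' < b ->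
  P (sample_path X @^-1` stays `[a', b'] s t) != 0%E ->
  P (sample_path X @^-1` leaps `]-oo, a] `[b, +oo[ s t) = 0%E /\
  P (sample_path X @^-1` leaps `[b, +oo[ `]-oo, a] s t) = 0%E.
Proof.
move=> hX s0 st aa bb /eqP S0.
have [cX _ _] := hX.
have mS : measurable (sample_path X @^-1` stays `[a', b'] s t).
  by apply: measurable_stays; exact: measurable_itv.
have mL : measurable (sample_path X @^-1` leaps `]-oo, a] `[b, +oo[ s t).
  by apply: measurable_leaps; exact: measurable_itv.
have mL' : measurable (sample_path X @^-1` leaps `[b, +oo[ `]-oo, a] s t).
  by apply: measurable_leaps; exact: measurable_itv.
have stayE w u : stays `[a', b'] s t (sample_path X w) -> s <= u <= t ->
    a' <= X u w <= b'.
  move=> Sw su; have := staysW (cX w) (@itv_closed _ _ a' b') s0 Sw su.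
  by rewrite /= in_itv.
have leapE w u : stays (`]-oo, a] `|` `[b, +oo[) s t (sample_path X w) ->
    s <= u <= t -> X u w <= a \/ b <= X u w.
  move=> Sw su; have cl : closed (`]-oo, a] `|` `[b, +oo[ : set R).
    by apply: closedU; [exact: lray_closed|exact: rray_closed].
  by have := staysW (cX w) cl s0 Sw su; rewrite /= !in_itv/= andbT.
have ss : s <= s <= t by rewrite lexx ltW.
have tt : s <= t <= t by rewrite lexx ltW.
have neq w v u : stays (`]-oo, a] `|` `[b, +oo[) s t (sample_path X w) ->
    stays `[a', b'] s t (sample_path X v) -> s < u < t -> X u w != X u v.
  move=> Lw Sv /andP[su ut]; have u' : s <= u <= t by rewrite !ltW.
  have /andP[av vb] := stayE _ _ Sv u'.
  by apply/eqP => e; have [|] := leapE _ _ Lw u'; rewrite e; lra.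
split.
- have [|//|/S0//] := crossing_rectangle_null hX s0 st mL mS.
  move=> w v [/= + + Lw] Sv; rewrite /sample_path !in_itv/= andbT => wa wb.
  have /andP[? ?] := stayE _ _ Sv ss; have /andP[? ?] := stayE _ _ Sv tt.
  by split; [lra|lra|move=> u; exact: neq].
- have [|/S0//|//] := crossing_rectangle_null hX s0 st mS mL'.
  move=> w v Sw [/= + + Lv]; rewrite /sample_path !in_itv/= andbT => wa wb.
  have /andP[? ?] := stayE _ _ Sw ss; have /andP[? ?] := stayE _ _ Sw tt.
  split; [lra|lra|move=> u su; rewrite eq_sym; apply: neq su => //].
  by rewrite setUC.
Qed.

(** * Mass inside the gap *)

Lemma rv_support_meets (V : {RV P >-> R}) C : measurable C ->
  P (V @^-1` C) != 0%E -> exists2 y, rv_support V y & C y.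
Proof.
move=> mC /eqP PC; apply: contrapT => H; apply: PC.
have mS : measurable (V @^-1` rv_support V).
  apply: measurable_rv_preimage; apply: closed_measurable.
  exact: closed_rv_support.
have off_support : P (~` (V @^-1` rv_support V)) = 0%E.
  by rewrite probability_setC// prob_rv_support subee.
apply: subset_measure0 off_support; first exact: measurable_rv_preimage.
  exact: measurableC.
by move=> w /= Cw Sw; apply: H; exists (V w).
Qed.

(** A connected support containing points on both sides of the gap contains its
    midpoint; were the gap null, its complement would be a closed set of full
    probability without the midpoint. *)
Lemma connected_support_mass (V : {RV P >-> R}) a b :
  connected (rv_support V) -> a < b ->
  P (V @^-1` `]-oo, a]) != 0%E -> P (V @^-1` `[b, +oo[) != 0%E ->
  P (V @^-1` `]a, b[) != 0%E.
Proof.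
move=> /connected_intervalP iV ab Pa Pb.
have [y Vy] := rv_support_meets (measurable_itv _) Pa.
have [z Vz] := rv_support_meets (measurable_itv _) Pb.
rewrite /= !in_itv/= andbT => bz ya.
have ym : y <= (a + b) / 2 <= z by apply/andP; split; lra.
have Vm := iV _ _ Vy Vz _ ym.
apply/eqP => P0; have := Vm (~` `]a, b[%classic); apply.
  split; first by apply/open_closedC/itv_open.
  rewrite -preimage_setC probability_setC ?P0 ?sube0//.
  by apply: measurable_rv_preimage; exact: measurable_itv.
by rewrite /= in_itv/=; apply/andP; split; lra.
Qed.

(** By right continuity every path with X_t in ]a, b[ stays there up to some
    rational q, so the events for the various q cover, and cannot all be null. *)
Lemma stays_mass X t t0 a b : cadlag X -> 0 <= t -> t < t0 ->
  P (X t @^-1` `]a, b[) != 0%E ->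
  exists2 q : rat, t < ratr q < t0 &
    P (sample_path X @^-1` stays `[a, b] t (ratr q)) != 0%E.
Proof.
move=> cX t_ge0 tt0 /eqP Pab; apply: contrapT => H; apply: Pab.
apply: measure_negligible.
  by apply: measurable_rv_preimage; exact: measurable_itv.
pose F (q : rat) := if t < ratr q < t0
  then sample_path X @^-1` stays `[a, b] t (ratr q) else set0.
apply: (@negligibleS _ _ _ _ (\bigcup_q F q)).
  move=> w /= Xw.
  have [|q tq Sq] := @stays_right R `[a, b]%classic t0 t _ (cX w) t_ge0 tt0.
    have : nbhs (X t w) `]a, b[%classic.
      by apply: open_nbhs_nbhs; split => //; exact: itv_open.
    by apply: filterS; exact: subset_itv_oo_cc.
  by exists q => //; rewrite /F tq.
apply: negligible_bigcup_countType => q; rewrite /F.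
case: ifPn => [tq|_]; last exact: negligible_set0.
apply/negligibleP; first by apply: measurable_stays; exact: measurable_itv.
by apply: contrapT => /eqP nP; apply: H; exists q.
Qed.

(** * The time at which a leap is likely *)

(** A and B stand for the two sides of the gap; keeping them abstract makes upward
    and downward leaps instances of the same statement. *)

Section leaps_null.
Variables (X : R -> {RV P >-> R}) (A B : set R) (s0 t0 e : R).
Hypotheses (cX : cadlag X) (pX : continuous_in_probability X).
Hypotheses (cA : closed A) (cB : closed B).
Hypothesis (e0 : 0 < e).
Hypothesis AB : forall y z, A y -> B z -> e < `|y - z|.
Hypotheses (s0_ge0 : 0 <= s0) (s0t0 : s0 < t0).

Let mA : measurable A. Proof. exact: closed_measurable. Qed.
Let mB : measurable B. Proof. exact: closed_measurable. Qed.

Let D := sample_path X @^-1` leaps A B s0 t0.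
Let DA t := D `&` X t @^-1` A.
Let phi t := fine (P (DA t)).

Let mD : measurable D. Proof. exact: measurable_leaps. Qed.
Let mDA t : measurable (DA t).
Proof. by apply: measurableI => //; exact: measurable_rv_preimage. Qed.

Let disj y : A y -> B y -> False.
Proof. by move=> Ay /(AB Ay); rewrite subrr normr0 ltNge ltW. Qed.

Let phiE t : P (DA t) = (phi t)%:E.
Proof. by rewrite fineK// fin_num_measure. Qed.

Let D_dichotomy w t : D w -> s0 <= t <= t0 -> A (X t w) \/ B (X t w).
Proof.
move=> [_ _ Sw] st.
exact: (staysW (cX w) (closedU cA cB) s0_ge0 Sw st).
Qed.

Let D_stays w t q : D w -> s0 <= t -> t <= q -> q <= t0 ->
  stays (A `|` B) t q (sample_path X w).
Proof.
move=> Dw st tq qt.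
split; [apply: D_dichotomy|apply: D_dichotomy|
        move=> r /andP[tr rq]; apply: D_dichotomy] => //; lra.
Qed.

(** On D the path is in A or B at each time of [s0, t0], hence whoever changes
    side between t and q leaps. *)
Let phi_eq t q : s0 <= t -> t <= q -> q <= t0 ->
  P (sample_path X @^-1` leaps A B t q) = 0%E ->
  P (sample_path X @^-1` leaps B A t q) = 0%E -> phi t = phi q.
Proof.
move=> st tq qt PAB PBA; congr fine; apply/eqP; rewrite eq_le.
have tt : s0 <= t <= t0 by lra.
have qq : s0 <= q <= t0 by lra.
apply/andP; split.
- apply: (le_measure_negligible _ _ (measurable_leaps X t q mA mB)) => //.
  move=> w [Dw Aw]; have [Aq|Bq] := D_dichotomy Dw qq; first by left.
  by right; split => //; exact: D_stays.
- apply: (le_measure_negligible _ _ (measurable_leaps X t q mB mA)) => //.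
  move=> w [Dw Aw]; have [At|Bt] := D_dichotomy Dw tt; first by left.
  by right; split => //; rewrite setUC; exact: D_stays.
Qed.

Let far t u := [set w | e < `|X u w - X t w|].

Let mfar t u : measurable (far t u).
Proof.
have -> : far t u = (fun w => `|X u w - X t w|) @^-1` `]e, +oo[.
  by apply/seteqP; split => w; rewrite /far/= in_itv/= andbT.
rewrite -[X in measurable X]setTI.
have : measurable_fun setT (fun w => `|X u w - X t w|).
  by apply: measurableT_comp => //; exact: measurable_funB.
by apply => //; exact: measurable_itv.
Qed.

(** Changing side is a move of more than e, so |phi t - phi u| is at most
    P(|X_u - X_t| > e), to which continuity in probability applies. *)
Let phi_continuous : {within `[s0, t0], continuous phi}.
Proof.
apply/subspace_continuousP => t; rewrite /= in_itv/= => tt.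
have t_ge0 : 0 <= t by case/andP: tt => /(le_trans s0_ge0).
have := pX t_ge0 e0.
move=> /fine_cvgP[_] /cvgrPdist_lt H; apply/cvgrPdist_lt => eps eps0.
have := H _ eps0; rewrite !near_withinE; apply: filterS => u /=.
rewrite sub0r normrN in_itv/= => Hu uu.
apply: le_lt_trans (Hu (le_trans s0_ge0 (proj1 (andP uu)))).
rewrite [leRHS]ger0_norm ?fine_ge0//.
have bound v w : s0 <= v <= t0 -> s0 <= w <= t0 ->
    far t u = far v w -> phi v <= phi w + fine (P (far t u)).
  move=> vv ww fE.
  rewrite -lee_fin EFinD -!phiE fineK ?fin_num_measure//.
  apply: (@le_trans _ _ (P (DA w `|` far v w))).
    apply: le_measure; rewrite ?inE//; first by apply: measurableU => //; exact: mfar.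
    move=> x [Dx Ax]; have [Aw|Bw] := D_dichotomy Dx ww; first by left.
    by right; rewrite /far/= distrC; exact: AB.
  by rewrite -fE; apply: measureU2 => //; exact: mfar.
have b1 := bound t u tt uu erefl.
have b2 : phi u <= phi t + fine (P (far t u)).
  by apply: bound => //; apply/seteqP; split => w; rewrite /far/= distrC.
have {}bound : `|phi t - phi u| <= fine (P (far t u)).
  move: (fine _) (phi t) (phi u) b1 b2 => p y z b1 b2.
  by rewrite ler_norml; apply/andP; split; lra.
exact: bound.
Qed.

(** If D had positive probability, phi would go down from P D to 0 continuously,
    and take a value v strictly in between that it has neither on N nor at
    rational times.  At a time t with phi t = v both sides have positive mass,
    so the hypothesis gives a rational q with no leap over [t, q], that is,
    phi q = v: a contradiction. *)
Lemma leaps_null (N : set R) : countable N ->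
  (forall t, s0 <= t -> t < t0 -> ~ N t ->
     P (X t @^-1` A) != 0%E -> P (X t @^-1` B) != 0%E ->
     exists2 q : rat, t < ratr q < t0 &
       P (sample_path X @^-1` leaps A B t (ratr q)) = 0%E /\
       P (sample_path X @^-1` leaps B A t (ratr q)) = 0%E) ->
  P D = 0%E.
Proof.
move=> cN hN.
have Ds0 : DA s0 = D by apply/seteqP; split => w; [case|move=> [? ? ?]; split].
have Dt0 : DA t0 = set0.
  by apply/seteqP; split => // w [[_ Bw _] Aw]; exact: (disj Aw Bw).
have phit0 : phi t0 = 0 by rewrite /phi Dt0 measure0.
have PD : P D = (phi s0)%:E by rewrite -phiE Ds0.
rewrite PD; congr EFin; apply/eqP; rewrite eq_le fine_ge0// andbT leNgt.
apply/negP => phis0.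
have cphi : countable (phi @` (N `|` range (@ratr R))).
  apply: sub_countable (card_image_le _ _) _; rewrite -bigcup2E.
  apply: bigcup_countable => // -[//|[|[|n]]] _ //=.
  by apply: sub_countable (card_image_le _ _) _; exact: countableP.
have [v /andP[v0 vs] nv] := countable_avoid cphi phis0.
have [|t] := IVT (ltW s0t0) phi_continuous (v := v).
  by rewrite phit0 ge_min le_max (ltW v0) (ltW vs) orbT.
rewrite in_itv/= => /andP[st tt] phit.
have {}tt : t < t0.
  rewrite lt_neqAle tt andbT; apply/eqP => tt0.
  by move: v0; rewrite -phit tt0 phit0 ltxx.
have mXA := measurable_rv_preimage (X t) mA.
have mXB := measurable_rv_preimage (X t) mB.
have PA : P (X t @^-1` A) != 0%E.
  apply/eqP => PA; move: v0; rewrite -phit -lte_fin -phiE.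
  rewrite (@subset_measure0 _ _ _ P _ _ (mDA t) mXA)// ?ltxx//.
  by move=> w [].
have PB : P (X t @^-1` B) != 0%E.
  apply/eqP => PB; move: vs; rewrite -phit ltNge -lee_fin -PD -phiE => /negP; apply.
  apply: (le_measure_negligible _ _ mXB) => // w Dw.
  have tt' : s0 <= t <= t0 by rewrite st ltW.
  by have [Aw|Bw] := D_dichotomy Dw tt'; [left; split|right].
have [|q /andP[tq qt] [P1 P2]] := hN t st tt _ PA PB.
  by move=> Nt; apply: nv; exists t => //; left.
apply: nv; exists (ratr q); first by right; exists q.
by rewrite -phit; apply/esym; apply: phi_eq => //; exact: ltW.
Qed.

End leaps_null.

(** * Continuity *)

(** The gap is shrunk to ]a', b'[ so that a path with values in [a', b'] is never
    level with one that leaps over ]a, b[. *)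
Lemma gap_leaps_null X (N : set R) a b s t :
  almost_continuous X -> countable N ->
  (forall u, 0 <= u -> ~ N u -> connected (rv_support (X u))) ->
  a < b -> 0 <= s -> s < t ->
  P (sample_path X @^-1` leaps `]-oo, a] `[b, +oo[ s t) = 0%E /\
  P (sample_path X @^-1` leaps `[b, +oo[ `]-oo, a] s t) = 0%E.
Proof.
move=> hX cN hN ab s0 st; have [cX pX _] := hX.
have no_leap_after u : s <= u -> u < t -> ~ N u ->
    P (X u @^-1` `]-oo, a]) != 0%E -> P (X u @^-1` `[b, +oo[) != 0%E ->
    exists2 q : rat, u < ratr q < t &
    P (sample_path X @^-1` leaps `]-oo, a] `[b, +oo[ u (ratr q)) = 0%E /\
    P (sample_path X @^-1` leaps `[b, +oo[ `]-oo, a] u (ratr q)) = 0%E.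
  move=> su ut Nu Pa Pb.
  have u0 := le_trans s0 su.
  pose a' := a + (b - a) / 3; pose b' := b - (b - a) / 3.
  have mono (C C' : set R) : measurable C -> measurable C' -> C `<=` C' ->
      P (X u @^-1` C) != 0%E -> P (X u @^-1` C') != 0%E.
    move=> mC mC' CC; apply: contraNN => /eqP P0; apply/eqP.
    apply: subset_measure0 P0; [exact: measurable_rv_preimage..|].
    by move=> w; exact: CC.
  have Pab : P (X u @^-1` `]a', b'[) != 0%E.
    apply: connected_support_mass; first exact: hN.
    - by rewrite /a' /b'; lra.
    - apply: mono Pa; [exact: measurable_itv..|move=> y].
      by rewrite /= !in_itv/= /a'; lra.
    - apply: mono Pb; [exact: measurable_itv..|move=> y].
      by rewrite /= !in_itv/= !andbT /b'; lra.
  have [q uqt PS] := stays_mass cX u0 ut Pab.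
  exists q => //; have /andP[uq _] := uqt.
  by apply: leaps_over_null PS => //; rewrite /a' /b'; lra.
(* half the width of the gap, as the two sides must be more than e apart *)
have e0 : 0 < (b - a) / 2 by lra.
split.
- apply: (leaps_null cX pX (@lray_closed _ _ a) (@rray_closed _ _ b) e0 _ s0 st cN)
    => //.
  move=> y z; rewrite /= !in_itv/= andbT => ya bz.
  by rewrite distrC ger0_norm; lra.
- apply: (leaps_null cX pX (@rray_closed _ _ b) (@lray_closed _ _ a) e0 _ s0 st cN)
    => //.
  + move=> y z; rewrite /= !in_itv/= andbT => yb za.
    by rewrite ger0_norm; lra.
  + by move=> u su ut Nu Pb Pa; have [q ? []] := no_leap_after u su ut Nu Pa Pb; exists q.
Qed.

End processes.

Unset Implicit Arguments.

Theorem lemma1p4 (R : realType) (d : measure_display) (T : measurableType d)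
    (P : probability T R) (X : R -> {RV P >-> R})
    (hX : almost_continuous X)
    (hsupp : exists N : set R, countable N /\
       forall t : R, 0 <= t -> ~ N t -> connected (rv_support (X t))) :
  continuous_process X.
Proof.
have [N [cN hN]] := hsupp; have [cX _ _] := hX.
(* rational gaps and times make the exceptional set a countable union *)
pose F (i : rat * rat * rat * rat) : set T :=
  let: (a, b, s, t) := i in
  if [&& ratr a < ratr b :> R, (0:R) <= ratr s & ratr s < ratr t :> R] then
    sample_path X @^-1` (leaps `]-oo, ratr a] `[ratr b, +oo[ (ratr s) (ratr t) `|`
      leaps `[ratr b, +oo[ `]-oo, ratr a] (ratr s) (ratr t))
  else set0.
apply: (@negligibleS _ _ _ _ (\bigcup_i F i)).
  move=> w /= /(discontinuity_leaps (cX w))[a [b [s [t [ab s0 st L]]]]].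
  by exists (a, b, s, t) => //; rewrite /F ab s0 st.
apply: negligible_bigcup_countType => -[[[a b] s] t] /=.
case: ifPn => [/and3P[ab s0 st]|_]; last exact: negligible_set0.
have [P1 P2] := gap_leaps_null hX cN hN ab s0 st.
by rewrite preimage_setU; apply: negligibleU; apply/negligibleP => //;
  apply: measurable_leaps; exact: measurable_itv.
Qed.
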